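(* Let $\varphi:\mathbb{R}^n\to\mathbb{R}$ be of class $\mathcal{C}^{1,1}$ and let $x^0\in\mathbb{R}^n$ be such that, with $\Omega:=\{x\in\mathbb{R}^n\mid \varphi(x)\le\varphi(x^0)\}$, for every $x\in\Omega$ the mapping $\partial^2\varphi(x)$ is positive-definite, i.e. $\langle z,u\rangle>0$ for all $u\neq0$ and all $z\in\partial^2\varphi(x)(u)$. Then: (i) any sequence $\{x^k\}$ generated by the Generalized Damped Newton Algorithm (with $\sigma\in(0,\tfrac12)$, $\beta\in(0,1)$) from $x^0$ is well-defined and $x^k\in\Omega$ for all $k$; (ii) all limiting points of $\{x^k\}$ are tilt-stable local minimizers of $\varphi$.
   Context: A function $\varphi:\mathbb{R}^n\to\mathbb{R}$ is of class $\mathcal{C}^{1,1}$ if it is continuously differentiable and $\nabla\varphi$ is Lipschitz continuous around every point. For $\Omega\subset\mathbb{R}^s$ and $\bar z\in\Omega$, the regular normal cone is $\widehat N_\Omega(\bar z):=\{v\mid \limsup_{z\to\bar z,\,z\in\Omega}\langle v,z-\bar z\rangle/\|z-\bar z\|\le 0\}$ and the limiting normal cone $N_\Omega(\bar z)$ is the set of all $v$ for which there exist $z_k\to\bar z$ with $z_k\in\Omega$ and $v_k\to v$ with $v_k\in\widehat N_\Omega(z_k)$. For $F:\mathbb{R}^n\rightrightarrows\mathbb{R}^m$ and $(\bar x,\bar y)\in\operatorname{gph}F$, $D^*F(\bar x,\bar y)(v):=\{u\mid (u,-v)\in N_{\operatorname{gph}F}(\bar x,\bar y)\}$. For $\varphi$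 of class $\mathcal{C}^{1,1}$, $\partial^2\varphi(x)(u):=D^*(\nabla\varphi)(x,\nabla\varphi(x))(u)$. A point $\bar x$ is a tilt-stable local minimizer of $\varphi$ if there is $\gamma>0$ such that $M_\gamma(v):=\operatorname{argmin}\{\varphi(x)-\langle v,x\rangle\mid x\in\mathbb{B}_\gamma(\bar x)\}$ is single-valued and Lipschitz continuous on a neighborhood of $0$ with $M_\gamma(0)=\{\bar x\}$. Generalized Damped Newton Algorithm: given $\sigma\in(0,\tfrac12)$, $\beta\in(0,1)$ and $x^0$, set $k=0$. If $\nabla\varphi(x^k)=0$ stop. Otherwise choose $d^k$ with $-\nabla\varphi(x^k)\in\partial^2\varphi(x^k)(d^k)$; set $\tau_k=1$ and, while $\varphi(x^k+\tau_kd^k)>\varphi(x^k)+\sigma\tau_k\langle\nabla\varphi(x^k),d^k\rangle$, replace $\tau_k$ by $\beta\tau_k$; set $x^{k+1}:=x^k+\tau_kd^k$, increase $k$ by 1 and repeat. *)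

(* Defs.v *)
(* R^n is 'rV[R]_n, with the Euclidean inner product
   and Euclidean norm defined below. Convergence of sequences and
   differentiability use the library notions (their topology on 'rV is the
   usual one on R^n). *)
From HB Require Import structures.
From mathcomp Require Import all_boot all_order all_algebra.
From mathcomp Require Import all_classical all_reals all_analysis.
Set Implicit Arguments. Unset Strict Implicit. Unset Printing Implicit Defensive.
Import Order.TTheory GRing.Theory Num.Theory.
Import numFieldNormedType.Exports.
Local Open Scope classical_set_scope.
Local Open Scope ring_scope.

Section Defs.
Variable R : realType.

Definition dot (n : nat) (u v : 'rV[R]_n) : R := \sum_(i < n) u 0 i * v 0 i.
Definition enorm (n : nat) (u : 'rV[R]_n) : R := Num.sqrt (dot u u).

Definition C11_with_gradient (n : nat) (phi : 'rV[R]_n -> R)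
    (G : 'rV[R]_n -> 'rV[R]_n) : Prop :=
  (forall x, differentiable phi x /\ forall h, 'd phi x h = dot (G x) h) /\
  continuous G /\
  (forall x, exists r, 0 < r /\ exists L : R,
     forall y z, enorm (y - x) < r -> enorm (z - x) < r ->
       enorm (G y - G z) <= L * enorm (y - z)).

(* regular normal cone: limsup_{z -> zbar, z in Om} <v, z - zbar>/|z - zbar| <= 0 *)
Definition reg_normal (s : nat) (Om : set 'rV[R]_s) (zbar : 'rV[R]_s) : set 'rV[R]_s :=
  [set v | forall e : R, 0 < e -> exists d : R, 0 < d /\
     forall z, Om z -> 0 < enorm (z - zbar) -> enorm (z - zbar) < d ->
       dot v (z - zbar) <= e * enorm (z - zbar)].

Definition lim_normal (s : nat) (Om : set 'rV[R]_s) (zbar : 'rV[R]_s) : set 'rV[R]_s :=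
  [set v | exists (zs vs : nat -> 'rV[R]_s),
     (forall k, Om (zs k)) /\ zs @ \oo --> zbar /\ vs @ \oo --> v /\
     (forall k, reg_normal Om (zs k) (vs k))].

Definition gph (n m : nat) (F : 'rV[R]_n -> set 'rV[R]_m) : set 'rV[R]_(n + m) :=
  [set w | exists x y, F x y /\ w = row_mx x y].

Definition coderiv (n m : nat) (F : 'rV[R]_n -> set 'rV[R]_m)
    (xbar : 'rV[R]_n) (ybar : 'rV[R]_m) (v : 'rV[R]_m) : set 'rV[R]_n :=
  [set u | lim_normal (gph F) (row_mx xbar ybar) (row_mx u (- v))].

(* generalized Hessian d^2 phi(x)(u) := D^*(grad phi)(x, grad phi x)(u),
   with G = grad phi *)
Definition gen_hessian (n : nat) (G : 'rV[R]_n -> 'rV[R]_n) (x u : 'rV[R]_n)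
  : set 'rV[R]_n :=
  coderiv (fun y => [set G y]) x (G x) u.

Definition hessian_posdef (n : nat) (G : 'rV[R]_n -> 'rV[R]_n) (x : 'rV[R]_n) : Prop :=
  forall u z, u != 0 -> gen_hessian G x u z -> 0 < dot z u.

Definition armijo (n : nat) (phi : 'rV[R]_n -> R) (G : 'rV[R]_n -> 'rV[R]_n)
    (sigma : R) (x d : 'rV[R]_n) (tau : R) : Prop :=
  phi (x + tau *: d) <= phi x + sigma * tau * dot (G x) d.

Definition gdna_step (n : nat) (phi : 'rV[R]_n -> R) (G : 'rV[R]_n -> 'rV[R]_n)
    (sigma beta : R) (x x' : 'rV[R]_n) : Prop :=
  G x != 0 /\
  exists d, gen_hessian G x d (- G x) /\
  exists j : nat, armijo phi G sigma x d (beta ^+ j) /\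
    (forall i : nat, (i < j)%N -> ~ armijo phi G sigma x d (beta ^+ i)) /\
    x' = x + beta ^+ j *: d.

Definition cball (n : nat) (xbar : 'rV[R]_n) (g : R) : set 'rV[R]_n :=
  [set x | enorm (x - xbar) <= g].

Definition M_tilt (n : nat) (phi : 'rV[R]_n -> R) (xbar : 'rV[R]_n) (g : R)
    (v : 'rV[R]_n) : set 'rV[R]_n :=
  [set x | cball xbar g x /\
     forall y, cball xbar g y -> phi x - dot v x <= phi y - dot v y].

Definition tilt_stable (n : nat) (phi : 'rV[R]_n -> R) (xbar : 'rV[R]_n) : Prop :=
  exists g : R, 0 < g /\
  exists (d : R) (m : 'rV[R]_n -> 'rV[R]_n) (L : R), 0 < d /\
    (forall v, enorm v < d -> M_tilt phi xbar g v = [set m v]) /\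
    (forall v w, enorm v < d -> enorm w < d ->
       enorm (m v - m w) <= L * enorm (v - w)) /\
    M_tilt phi xbar g 0 = [set xbar].

Definition limiting_point (n : nat) (x : nat -> 'rV[R]_n) (xbar : 'rV[R]_n) : Prop :=
  exists p : nat -> nat, (forall i j, (i < j)%N -> (p i < p j)%N) /\
    (x \o p) @ \oo --> xbar.

End Defs.

(* Main.v *)
Require Import Defs.
From HB Require Import structures.
From mathcomp Require Import all_boot all_order all_algebra.
From mathcomp Require Import all_classical all_reals all_analysis.
From mathcomp Require Import ring lra.
Import Order.TTheory GRing.Theory Num.Theory.
Import numFieldNormedType.Exports.
Local Open Scope classical_set_scope.
Local Open Scope ring_scope.

(** By compactness, positive definiteness of the limiting coderivative at [x]
    gives [k > 0] with [k |u|^2 <= <z, u>] for all coderivatives at points near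
    [x]. A penalised mean value argument turns this into strong monotonicity of
    the gradient [G] near [x]. Consequently:
    - [v] belongs to the generalized Hessian at [x] in some direction, obtained
      as a limit of [2 K (G y - G x)] with [y] minimising
      [K |G y - G x|^2 - <v, y>], [K -> oo], so Newton directions exist;
    - Newton directions [d] satisfy [k |d|^2 <= - <G x, d>] and [|G x| <= L |d|],
      so near a non-stationary point each step decreases [phi] by a fixed amount,
      and hence limiting points are stationary;
    - at a stationary point, adding the variational inequalities of two tilted
      minimisers shows that the tilted argmin is single-valued and
      [1/k]-Lipschitz. *)

(** * Euclidean inner product and norm *)

Lemma dotC {R : realType} {n} (u v : 'rV[R]_n) : dot u v = dot v u.
Proof. by apply: eq_bigr => i _; rewrite mulrC. Qed.

Lemma dotDl {R : realType} {n} (u v w : 'rV[R]_n) :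
  dot (u + v) w = dot u w + dot v w.
Proof. by rewrite -big_split; apply: eq_bigr => i _; rewrite mxE mulrDl. Qed.

Lemma dotZl {R : realType} {n} (a : R) (u v : 'rV[R]_n) :
  dot (a *: u) v = a * dot u v.
Proof. by rewrite mulr_sumr; apply: eq_bigr => i _; rewrite mxE mulrA. Qed.

Lemma dotNl {R : realType} {n} (u v : 'rV[R]_n) : dot (- u) v = - dot u v.
Proof. by rewrite -scaleN1r dotZl mulN1r. Qed.

Lemma dot0l {R : realType} {n} (u : 'rV[R]_n) : dot 0 u = 0.
Proof. by rewrite -(scale0r 0) dotZl mul0r. Qed.

Lemma dotDr {R : realType} {n} (u v w : 'rV[R]_n) :
  dot u (v + w) = dot u v + dot u w.
Proof. by rewrite dotC dotDl !(dotC u). Qed.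

Lemma dotZr {R : realType} {n} (a : R) (u v : 'rV[R]_n) :
  dot u (a *: v) = a * dot u v.
Proof. by rewrite dotC dotZl dotC. Qed.

Lemma dotNr {R : realType} {n} (u v : 'rV[R]_n) : dot u (- v) = - dot u v.
Proof. by rewrite dotC dotNl dotC. Qed.

Lemma dot0r {R : realType} {n} (u : 'rV[R]_n) : dot u 0 = 0.
Proof. by rewrite dotC dot0l. Qed.

Definition dotE := (@dotDl, @dotDr, @dotNl, @dotNr, @dotZl, @dotZr, @dot0l, @dot0r).

Lemma dot_row_mx {R : realType} {n m} (a c : 'rV[R]_n) (b d : 'rV[R]_m) :
  dot (row_mx a b) (row_mx c d) = dot a c + dot b d.
Proof.
rewrite /dot big_split_ord /=.
by congr (_ + _); apply: eq_bigr => i _; rewrite ?row_mxEl ?row_mxEr.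
Qed.

Lemma dot_ge0 {R : realType} {n} (u : 'rV[R]_n) : 0 <= dot u u.
Proof. by apply: sumr_ge0 => i _; rewrite -expr2 sqr_ge0. Qed.

Lemma enorm_ge0 {R : realType} {n} (u : 'rV[R]_n) : 0 <= enorm u.
Proof. exact: sqrtr_ge0. Qed.

Lemma sqr_enorm {R : realType} {n} (u : 'rV[R]_n) : enorm u ^+ 2 = dot u u.
Proof. by rewrite sqr_sqrtr // dot_ge0. Qed.

Lemma enorm0 {R : realType} {n} : enorm (0 : 'rV[R]_n) = 0.
Proof. by rewrite /enorm dot0l sqrtr0. Qed.

Lemma enormN {R : realType} {n} (u : 'rV[R]_n) : enorm (- u) = enorm u.
Proof. by rewrite /enorm dotNl dotNr opprK. Qed.

Lemma enormB {R : realType} {n} (u v : 'rV[R]_n) : enorm (u - v) = enorm (v - u).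
Proof. by rewrite -enormN opprB. Qed.

Lemma enormZ {R : realType} {n} (a : R) (u : 'rV[R]_n) :
  enorm (a *: u) = `|a| * enorm u.
Proof.
by rewrite /enorm dotZl dotZr mulrA -expr2 sqrtrM ?sqr_ge0 // sqrtr_sqr.
Qed.

Lemma coord_le_enorm {R : realType} {n} (u : 'rV[R]_n) i : `|u 0 i| <= enorm u.
Proof.
rewrite -sqrtr_sqr ler_wsqrtr // /dot (bigD1 i) //= -expr2 lerDl.
by apply: sumr_ge0 => j _; rewrite -expr2 sqr_ge0.
Qed.

Lemma enorm_eq0 {R : realType} {n} (u : 'rV[R]_n) : enorm u = 0 -> u = 0.
Proof.
move=> u0; apply/rowP => i; rewrite mxE; apply/eqP.
by rewrite -normr_le0 -u0 coord_le_enorm.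
Qed.

Lemma enorm_gt0 {R : realType} {n} (u : 'rV[R]_n) : u != 0 -> 0 < enorm u.
Proof.
by move=> u0; rewrite lt0r enorm_ge0 andbT; apply: contra_neq u0; exact: enorm_eq0.
Qed.

Lemma dot_le_enorm {R : realType} {n} (u v : 'rV[R]_n) :
  dot u v <= enorm u * enorm v.
Proof.
have [->|v0] := eqVneq v 0; first by rewrite dot0r enorm0 mulr0.
have [->|u0] := eqVneq u 0; first by rewrite dot0l enorm0 mul0r.
have Nu := enorm_gt0 _ u0; have Nv := enorm_gt0 _ v0.
(* The square of [enorm v *: u - enorm u *: v] expands to [2 |u| |v| (|u| |v| - <u, v>)], whose sign
   gives Cauchy-Schwarz. *)
have := dot_ge0 (enorm v *: u - enorm u *: v).
rewrite !dotE -!sqr_enorm (dotC v u) => h.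
have : 0 <= 2 * (enorm u * enorm v) * (enorm u * enorm v - dot u v).
  by apply: le_trans h _; rewrite le_eqVlt; apply/orP; left; apply/eqP; ring.
by rewrite pmulr_rge0 ?subr_ge0 // !mulr_gt0.
Qed.

Lemma normr_dot_le {R : realType} {n} (u v : 'rV[R]_n) :
  `|dot u v| <= enorm u * enorm v.
Proof.
by rewrite ler_norml dot_le_enorm andbT lerNl -dotNl -(enormN u) dot_le_enorm.
Qed.

Lemma enormD {R : realType} {n} (u v : 'rV[R]_n) :
  enorm (u + v) <= enorm u + enorm v.
Proof.
rewrite -(@ler_pXn2r _ 2) ?nnegrE ?addr_ge0 ?enorm_ge0 //.
rewrite sqr_enorm !dotE (dotC v u) sqrrD !sqr_enorm.
have := dot_le_enorm u v; lra.
Qed.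

Lemma enorm_dist {R : realType} {n} (v u w : 'rV[R]_n) :
  enorm (u - w) <= enorm (u - v) + enorm (v - w).
Proof. by have := enormD (u - v) (v - w); rewrite addrA subrK. Qed.

Lemma enorm_row_mx_l {R : realType} {n m} (a : 'rV[R]_n) (b : 'rV[R]_m) :
  enorm a <= enorm (row_mx a b).
Proof. by rewrite ler_wsqrtr // dot_row_mx lerDl dot_ge0. Qed.

Lemma enorm_row_mx_r {R : realType} {n m} (a : 'rV[R]_n) (b : 'rV[R]_m) :
  enorm b <= enorm (row_mx a b).
Proof. by rewrite ler_wsqrtr // dot_row_mx lerDr dot_ge0. Qed.

Lemma enorm_row_mx_le {R : realType} {n m} (a : 'rV[R]_n) (b : 'rV[R]_m) :
  enorm (row_mx a b) <= enorm a + enorm b.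
Proof.
have := enorm_ge0 a; have := enorm_ge0 b => b0 a0.
rewrite -(@ler_pXn2r _ 2) ?nnegrE ?addr_ge0 ?enorm_ge0 //.
rewrite sqr_enorm dot_row_mx -!sqr_enorm sqrrD; nra.
Qed.

Lemma sub_row_mx {R : realType} {n m} (a c : 'rV[R]_n) (b d : 'rV[R]_m) :
  row_mx a b - row_mx c d = row_mx (a - c) (b - d).
Proof. by rewrite opp_row_mx add_row_mx. Qed.

Lemma norm_le_enorm {R : realType} {n} (u : 'rV[R]_n) : `|u| <= enorm u.
Proof.
have [->|u0] := eqVneq `|u| 0; first exact: enorm_ge0.
have [[i j] uE] := mx_norm_neq0 u0.
by rewrite [leLHS]uE /= ord1 coord_le_enorm.
Qed.

Lemma coord_le_norm {R : realType} {n} (u : 'rV[R]_n) i : `|u 0 i| <= `|u|.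
Proof.
rewrite [leRHS]mx_normrE.
exact: (le_bigmax _ (fun ij : 'I_1 * 'I_n => `|u ij.1 ij.2|) (0, i)).
Qed.

(** The ambient norm is the maximum norm. The crude factor [n.+1] instead of the square root of [n]
    stays invertible when [n = 0]. *)
Lemma enorm_le_norm {R : realType} {n} (u : 'rV[R]_n) : enorm u <= n.+1%:R * `|u|.
Proof.
have N0 : 0 <= n.+1%:R * `|u| by rewrite mulr_ge0.
rewrite -[leRHS](ger0_norm N0) -sqrtr_sqr ler_wsqrtr //.
apply: (@le_trans _ _ (\sum_(i < n) `|u| ^+ 2)).
  apply: ler_sum => i _; rewrite -expr2 -real_normK ?num_real //.
  by rewrite lerXn2r ?nnegrE ?coord_le_norm.
rewrite sumr_const card_ord -(mulr_natl (_ ^+ 2)) exprMn ler_wpM2r ?sqr_ge0 //.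
by rewrite -natrX ler_nat (leq_trans (leqnSn n)) // leq_pmulr.
Qed.

(** * Continuity, compactness and convergence in the Euclidean norm *)

Lemma continuous_dot {R : realType} {n} {T : topologicalType}
    (f g : T -> 'rV[R]_n) :
  continuous f -> continuous g -> continuous (fun x => dot (f x) (g x)).
Proof.
move=> cf cg x; apply: cvg_big => [|i _]; first exact: add_continuous.
have coordi h : continuous h -> (fun x : T => (h x : 'rV[R]_n) 0 i) @ x --> h x 0 i.
  move=> ch; apply: (@continuous_comp _ _ _ h (fun u : 'rV[R]_n => u 0 i)).
    exact: ch.
  exact: coord_continuous.
by apply: cvgM; apply: coordi.
Qed.

Lemma continuous_enorm {R : realType} {n} {T : topologicalType}
    (f : T -> 'rV[R]_n) :
  continuous f -> continuous (fun x => enorm (f x)).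
Proof.
move=> cf x; apply: (continuous_comp (f := fun x => dot (f x) (f x))).
  exact: continuous_dot.
exact: sqrt_continuous.
Qed.

Lemma continuous_sub {K : numFieldType} {V : normedModType K}
    {T : topologicalType} (f g : T -> V) :
  continuous f -> continuous g -> continuous (fun x => f x - g x).
Proof. by move=> cf cg x; apply: cvgB; [exact: cf|exact: cg]. Qed.

Lemma continuous_mull {K : numFieldType} {T : topologicalType} (a : K) (f : T -> K) :
  continuous f -> continuous (fun x => a * f x).
Proof. by move=> cf x; apply: cvgM; [exact: cvg_cst|exact: cf]. Qed.

Lemma continuous_id {T : topologicalType} : continuous (fun x : T => x).
Proof. by move=> x; apply: cvg_id. Qed.

Lemma continuous_cst {T U : topologicalType} (a : U) : continuous (fun _ : T => a).
Proof. by move=> x; apply: cvg_cst. Qed.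

Lemma compact_cball {R : realType} {n} (x : 'rV[R]_n) (r : R) :
  compact (cball x r).
Proof.
apply: bounded_closed_compact; last first.
  apply: (@preimage_closed 'rV[R]_n R (fun y => enorm (y - x)) [set t | t <= r]).
    move=> y _; apply: continuous_enorm.
    by apply: continuous_sub; [exact: continuous_id|exact: continuous_cst].
  exact: closed_le.
exists (r + enorm x); split; first exact: num_real.
move=> M ltM y /= xy; apply: le_trans (norm_le_enorm _) _.
apply: le_trans (ltW ltM); rewrite -[y](subrK x).
by apply: le_trans (enormD _ _) _; rewrite lerD2r.
Qed.

Lemma cball_argmin {R : realType} {n} (f : 'rV[R]_n -> R) (x : 'rV[R]_n) (r : R) :
  0 <= r -> continuous f ->
  exists2 c, enorm (c - x) <= r & forall y, enorm (y - x) <= r -> f c <= f y.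
Proof.
move=> r0 cf; have [||c] := @EVT_min_rV R n f (cball x r) _ (compact_cball _ _).
- by exists x; rewrite /cball /= subrr enorm0.
- exact: continuous_subspaceT.
rewrite inE => xc minc; exists c => // y xy; apply: minc; rewrite inE; exact: xy.
Qed.

Lemma cvg_enormP {R : realType} {n} (u : nat -> 'rV[R]_n) (x : 'rV[R]_n) :
  u @ \oo --> x <->
  forall e : R, 0 < e -> exists N, forall k, (N <= k)%N -> enorm (u k - x) < e.
Proof.
split => [/cvgrPdist_lt cux e e0|eux].
  have [|N _ uN] := cux (e / n.+1%:R); first by rewrite divr_gt0.
  exists N => k Nk; rewrite enormB; apply: le_lt_trans (enorm_le_norm _) _.
  by rewrite mulrC -ltr_pdivlMr //; exact: uN.
apply/cvgrPdist_lt => e e0; have [N uN] := eux e e0; exists N => // k /= Nk.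
by apply: le_lt_trans (norm_le_enorm _) _; rewrite enormB uN.
Qed.

(** A cluster point met at arbitrarily late indices replaces a convergent subsequence: later uses
    need only single terms that are both close and late. *)
Lemma bounded_cluster {R : realType} {n} (u : nat -> 'rV[R]_n) (M : R) :
  (forall k, enorm (u k) <= M) ->
  exists p, forall e : R, 0 < e -> forall N, exists2 k, (N <= k)%N & enorm (u k - p) < e.
Proof.
move=> uM; have [|p [_ clp]] := @compact_cball R n 0 M (u @ \oo).
  by exists 0%N => // k _; rewrite /cball /= subr0.
exists p => e e0 N.
have [||_ [[k Nk <-] pk]] :=
    clp [set u k | k in [set k | (N <= k)%N]] [set y | `|p - y| < e / n.+1%:R].
- by exists N => // k /= Nk; exists k.
- by apply/nbhs_ballP; exists (e / n.+1%:R); rewrite /= ?divr_gt0 // mx_norm_ball.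
exists k => //; rewrite enormB; apply: le_lt_trans (enorm_le_norm _) _.
by rewrite mulrC -ltr_pdivlMr.
Qed.

(** * Epsilon forms of limiting normals and coderivatives *)

Lemma invS_lt {R : realType} (e : R) :
  0 < e -> exists N, forall k, (N <= k)%N -> k.+1%:R^-1 < e.
Proof.
move=> e0; have [N _ NP] := nbhs_infty_gtr e^-1.
exists N => k Nk; rewrite -[e]invrK ltf_pV2 ?posrE ?invr_gt0 //.
by apply: lt_trans (NP k Nk) _; rewrite ltr_nat.
Qed.

Lemma lim_normalP {R : realType} {s} (Om : set 'rV[R]_s) (z v : 'rV[R]_s) :
  lim_normal Om z v <->
  forall e : R, 0 < e -> exists z' v', [/\ Om z', enorm (z' - z) < e,
    enorm (v' - v) < e & reg_normal Om z' v'].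
Proof.
split=> [[zs [vs [Omz [/cvg_enormP cz [/cvg_enormP cv nv]]]]] e e0|ev].
  have [N zN] := cz e e0; have [N' vN] := cv e e0.
  exists (zs (maxn N N')), (vs (maxn N N')); split => //.
    by apply: zN; rewrite leq_maxl.
  by apply: vN; rewrite leq_maxr.
have e_gt0 k : 0 < k.+1%:R^-1 :> R by rewrite invr_gt0.
have /choice[w wP] (k : nat) : exists w : 'rV[R]_s * 'rV[R]_s,
    [/\ Om w.1, enorm (w.1 - z) < k.+1%:R^-1,
    enorm (w.2 - v) < k.+1%:R^-1 & reg_normal Om w.1 w.2].
  by have [z' [v' ?]] := ev _ (e_gt0 k); exists (z', v').
exists (fst \o w), (snd \o w); split; first by move=> k; case: (wP k).
split.
  apply/cvg_enormP => e /invS_lt[N NP]; exists N => k /NP; apply: lt_trans.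
  by case: (wP k).
split; last by move=> k; case: (wP k).
apply/cvg_enormP => e /invS_lt[N NP]; exists N => k /NP; apply: lt_trans.
by case: (wP k).
Qed.

Lemma dot_near {R : realType} {n} (z u : 'rV[R]_n) (e : R) : 0 < e ->
  exists2 d : R, 0 < d & forall z' u', enorm (z' - z) < d -> enorm (u' - u) < d ->
    `|dot z' u' - dot z u| < e.
Proof.
move=> e0; set S := enorm u + enorm z + 2.
have u0 := enorm_ge0 u; have z0 := enorm_ge0 z.
have S0 : 0 < S by rewrite /S; lra.
have d0 : 0 < e / S by rewrite divr_gt0.
exists (Num.min 1 (e / S)); first by rewrite lt_min ltr01 d0.
move=> z' u'; rewrite !lt_min => /andP[z1 zd] /andP[u1 ud].
have -> : dot z' u' - dot z u = dot (z' - z) u' + dot z (u' - u).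
  by rewrite !dotE; ring.
have u'1 : enorm u' <= enorm u + 1.
  by rewrite -[u' in enorm u'](subrK u) addrC (le_trans (enormD _ _)) // lerD2l ltW.
apply: le_lt_trans (ler_normD _ _) _.
apply: le_lt_trans (lerD (normr_dot_le _ _) (normr_dot_le _ _)) _.
have eS : e = e / S * S by rewrite divfK // gt_eqF.
rewrite [ltRHS]eS /S.
have := enorm_ge0 (z' - z); have := enorm_ge0 (u' - u); have := enorm_ge0 u'.
nra.
Qed.

(* [z] lies in the regular coderivative of [G] at [y] in direction [u]. *)
Definition reg_hessian {R : realType} {n} (G : 'rV[R]_n -> 'rV[R]_n)
    (y u z : 'rV[R]_n) : Prop :=
  reg_normal (gph (fun x => [set G x])) (row_mx y (G y)) (row_mx z (- u)).

Lemma reg_hessianP {R : realType} {n} (G : 'rV[R]_n -> 'rV[R]_n) (y u z : 'rV[R]_n) :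
  reg_hessian G y u z <->
  forall e : R, 0 < e -> exists2 d : R, 0 < d & forall y',
    0 < enorm (row_mx (y' - y) (G y' - G y)) < d ->
    dot z (y' - y) - dot u (G y' - G y) <=
      e * enorm (row_mx (y' - y) (G y' - G y)).
Proof.
split=> [nzu e /nzu[d [d0 dP]]|H e /H[d d0 dP]]; exists d => //.
  move=> y' /andP[y'0 y'd].
  have := dP (row_mx y' (G y')); rewrite sub_row_mx dot_row_mx dotNl; apply=> //.
  by exists y', (G y').
split=> // _ [y' [_ [-> ->]]]; rewrite sub_row_mx dot_row_mx dotNl => y'0 y'd.
by apply: dP; rewrite y'0 y'd.
Qed.

Lemma reg_hessianZ {R : realType} {n} (G : 'rV[R]_n -> 'rV[R]_n) (y u z : 'rV[R]_n)
    (a : R) :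
  0 < a -> reg_hessian G y u z -> reg_hessian G y (a *: u) (a *: z).
Proof.
move=> a0 /reg_hessianP nzu; apply/reg_hessianP => e e0.
have [|d d0 dP] := nzu (e / a); first by rewrite divr_gt0.
exists d => // y' /dP; rewrite !dotZl -mulrBr -ler_pdivlMl //.
by rewrite mulrCA mulrA.
Qed.

(** Proximal normals are regular normals: a quadratic error is at most [e] times the length of the
    graph displacement once that displacement is short. Minimisers of quadratically penalised
    functions supply such bounds. *)
Lemma proximal_reg_hessian {R : realType} {n} (G : 'rV[R]_n -> 'rV[R]_n)
    (y u z : 'rV[R]_n) (r K : R) :
  0 < r -> 0 <= K ->
  (forall y', enorm (y' - y) < r -> dot z (y' - y) - dot u (G y' - G y) <=
      K * (enorm (y' - y) ^+ 2 + enorm (G y' - G y) ^+ 2)) ->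
  reg_hessian G y u z.
Proof.
move=> r0 K0 H; apply/reg_hessianP => e e0.
have K1 : 0 < K + 1 by lra.
exists (Num.min r (e / (K + 1))); first by rewrite lt_min r0 divr_gt0.
move=> y'; rewrite lt_min ltr_pdivlMr // => /and3P[p0 pr pe].
apply: le_trans (H y' _) _; first exact: le_lt_trans (enorm_row_mx_l _ _) pr.
rewrite !sqr_enorm -dot_row_mx -sqr_enorm.
nra.
Qed.

(** Graph points near [row_mx x (G x)] are parametrised by their first block; continuity of [G]
    makes the second block close automatically. *)
Lemma gen_hessianP {R : realType} {n} (G : 'rV[R]_n -> 'rV[R]_n) (x u z : 'rV[R]_n) :
  continuous G ->
  gen_hessian G x u z <->
  forall e : R, 0 < e -> exists y u' z', [/\ enorm (y - x) < e,
    enorm (u' - u) < e, enorm (z' - z) < e & reg_hessian G y u' z'].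
Proof.
move=> cG; split=> [/lim_normalP H e /H|H].
  move=> [_ [v' [[y [_ [-> ->]]] yx vz nv]]].
  exists y, (- rsubmx v'), (lsubmx v').
  move: yx vz nv; rewrite -{1 2}[v']hsubmxK !sub_row_mx opprK => yx vz nv.
  split.
  - exact: le_lt_trans (enorm_row_mx_l _ _) yx.
  - rewrite -opprD enormN; exact: le_lt_trans (enorm_row_mx_r _ _) vz.
  - exact: le_lt_trans (enorm_row_mx_l _ _) vz.
  - by rewrite /reg_hessian opprK.
apply/lim_normalP => e e0.
have e2 : 0 < e / 2 by rewrite divr_gt0.
have /(_ x)/cvgrPdist_lt/(_ (e / 2 / n.+1%:R)) := cG.
rewrite divr_gt0 // => /(_ isT)/nbhs_ballP[d /= d0 dP].
have [|y [u' [z' [yx uu zz nzu]]]] := H (Num.min d (e / 2)).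
  by rewrite lt_min d0.
move: yx uu zz; rewrite !lt_min => /andP[yd ye] /andP[_ ue] /andP[_ ze].
exists (row_mx y (G y)), (row_mx z' (- u')); split => //.
- by exists y, (G y).
- rewrite sub_row_mx; apply: le_lt_trans (enorm_row_mx_le _ _) _.
  rewrite [ltRHS]splitr ltrD // enormB; apply: le_lt_trans (enorm_le_norm _) _.
  rewrite mulrC -ltr_pdivlMr //; apply: dP.
  rewrite mx_norm_ball /ball_ /=; apply: le_lt_trans (norm_le_enorm _) _.
  by rewrite enormB.
- rewrite sub_row_mx; apply: le_lt_trans (enorm_row_mx_le _ _) _.
  by rewrite [ltRHS]splitr ltrD // -opprD enormN.
Qed.

(** * Bounds and coercivity of coderivatives *)

Definition lipschitz_near {R : realType} {n} (G : 'rV[R]_n -> 'rV[R]_n)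
    (x : 'rV[R]_n) (r L : R) : Prop :=
  forall y z, enorm (y - x) < r -> enorm (z - x) < r ->
    enorm (G y - G z) <= L * enorm (y - z).

(** Testing the normal inequality with the displacement [t *: z] gives
    [t |z|^2 <= <u, G (y + t z) - G y>] up to a small error, and the right side is at most
    [L |u| t |z|]. *)
Lemma reg_hessian_le {R : realType} {n} (G : 'rV[R]_n -> 'rV[R]_n)
    (x y u z : 'rV[R]_n) (r L : R) :
  0 < L -> lipschitz_near G x r L -> enorm (y - x) < r ->
  reg_hessian G y u z -> enorm z <= L * enorm u.
Proof.
move=> L0 lipG yx /reg_hessianP nzu.
have [->|z_neq0] := eqVneq z 0; first by rewrite enorm0 mulr_ge0 ?enorm_ge0 ?ltW.
have z0 := enorm_gt0 _ z_neq0.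
apply/ler_addgt0Pr => e e0.
have L1 : 0 < 1 + L by lra.
have [|d d0 dP] := nzu (e / (1 + L)); first by rewrite divr_gt0.
(* Half of the admissible length: [y + t *: z] stays in the Lipschitz ball, and the graph
   displacement, at most [(1 + L) t |z|], stays below [d]. *)
set t := Num.min (r - enorm (y - x)) (d / (1 + L)) / (2 * enorm z).
have m0 : 0 < Num.min (r - enorm (y - x)) (d / (1 + L)).
  by rewrite lt_min subr_gt0 yx divr_gt0.
have t0 : 0 < t by rewrite divr_gt0 // mulr_gt0.
have tz : t * enorm z = Num.min (r - enorm (y - x)) (d / (1 + L)) / 2.
  by rewrite /t; field; rewrite gt_eqF.
have tz_lt : t * enorm z < Num.min (r - enorm (y - x)) (d / (1 + L)).
  by rewrite tz; lra.
move: tz_lt; rewrite lt_min ltr_pdivlMr // => /andP[tzr tzd].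
have tz0 : 0 < t * enorm z by rewrite mulr_gt0.
have y'y : (y + t *: z) - y = t *: z by rewrite addrAC subrr add0r.
have Ntz : enorm (t *: z) = t * enorm z by rewrite enormZ gtr0_norm.
have GL : enorm (G (y + t *: z) - G y) <= L * (t * enorm z).
  rewrite -Ntz -[in leRHS]y'y; apply: lipG => //.
  rewrite addrAC; apply: le_lt_trans (enormD _ _) _.
  by rewrite Ntz -ltrBrDl.
have Nrow : enorm (row_mx (t *: z) (G (y + t *: z) - G y)) <= (1 + L) * (t * enorm z).
  by apply: le_trans (enorm_row_mx_le _ _) _; rewrite Ntz mulrDl mul1r lerD2l.
have := dP (y + t *: z); rewrite y'y => /(_ _)/le_trans H.
have : dot z (t *: z) - dot u (G (y + t *: z) - G y) <= e * (t * enorm z).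
  apply: H.
    apply/andP; split.
      by apply: lt_le_trans (enorm_row_mx_l _ _); rewrite Ntz.
    by apply: le_lt_trans Nrow _; rewrite mulrC.
  by rewrite mulrAC ler_pdivrMr // -mulrA ler_pM2l // (mulrC _ (1 + L)).
rewrite dotZr -sqr_enorm => Ht.
have := le_trans (dot_le_enorm u (G (y + t *: z) - G y))
  (ler_wpM2l (enorm_ge0 u) GL) => Hu.
rewrite -(ler_pM2l tz0); nra.
Qed.

Lemma gen_hessian_le {R : realType} {n} (G : 'rV[R]_n -> 'rV[R]_n)
    (x y u z : 'rV[R]_n) (r L : R) :
  continuous G -> 0 < L -> lipschitz_near G x r L -> enorm (y - x) < r ->
  gen_hessian G y u z -> enorm z <= L * enorm u.
Proof.
move=> cG L0 lipG yx /(gen_hessianP _ _ _ _ cG) H.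
have L1 : 0 < 1 + L by lra.
apply/ler_addgt0Pr => e e0.
(* An error [e / (1 + L)] in both [u] and [z] costs at most [e] in [|z| <= L |u|]. *)
have [|y' [u' [z' [yy uu zz nzu]]]] := H (Num.min (r - enorm (y - x)) (e / (1 + L))).
  by rewrite lt_min subr_gt0 yx divr_gt0.
move: yy uu zz; rewrite !lt_min !ltr_pdivlMr // => /andP[yr _] /andP[_ ue] /andP[_ ze].
have y'x : enorm (y' - x) < r by have := enorm_dist y y' x; lra.
have := reg_hessian_le _ _ _ _ _ _ _ L0 lipG y'x nzu.
have := enormD (z - z') z'; rewrite subrK (enormB z z').
have := enormD (u' - u) u; rewrite subrK.
nra.
Qed.

Lemma gen_hessian_coercive {R : realType} {n} (G : 'rV[R]_n -> 'rV[R]_n)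
    (x y u z : 'rV[R]_n) (r k : R) :
  continuous G -> 0 < k ->
  (forall y u z, enorm (y - x) < r -> reg_hessian G y u z -> k * dot u u <= dot z u) ->
  enorm (y - x) < r -> gen_hessian G y u z -> k * dot u u <= dot z u.
Proof.
move=> cG k0 coer yx /(gen_hessianP _ _ _ _ cG) H.
have k1 : 0 < 1 + k by lra.
apply/ler_addgt0Pr => e e0.
have e1 : 0 < e / (1 + k) by rewrite divr_gt0.
have [d d0 dP] := dot_near z u _ e1; have [d' d'0 dP'] := dot_near u u _ e1.
have [|y' [u' [z' [yy uu zz nzu]]]] := H (Num.min (r - enorm (y - x)) (Num.min d d')).
  by rewrite !lt_min subr_gt0 yx d0.
move: yy uu zz; rewrite !lt_min => /and3P[yr _ _] /and3P[_ ud ud'] /and3P[_ zd _].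
have y'x : enorm (y' - x) < r by have := enorm_dist y y' x; lra.
have := coer _ _ _ y'x nzu.
have := dP _ _ zd ud; have := dP' _ _ ud' ud'; rewrite !ltr_norml.
have eE : e = e / (1 + k) * (1 + k) by rewrite divfK // gt_eqF.
set a := e / (1 + k) in eE *; move=> /andP[+ _] /andP[_ +]; nra.
Qed.

(* Otherwise normalised counterexamples would, by compactness, converge to a
   direction [u != 0] with some [z] in the limiting coderivative at [x] and
   [dot z u <= 0]. *)
Lemma posdef_coercive {R : realType} {n} (G : 'rV[R]_n -> 'rV[R]_n)
    (x : 'rV[R]_n) (r L : R) :
  continuous G -> 0 < r -> 0 < L -> lipschitz_near G x r L -> hessian_posdef G x ->
  exists k r' : R, [/\ 0 < k, 0 < r', r' <= r & forall y u z, enorm (y - x) < r' ->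
    reg_hessian G y u z -> k * dot u u <= dot z u].
Proof.
move=> cG r0 L0 lipG pd; apply: contrapT => noncoer.
have e_gt0 k : 0 < k.+1%:R^-1 :> R by rewrite invr_gt0.
(* The coderivative value and its direction are packed into the single row [w.2], so that one
   compactness argument yields limits of both. *)
have /choice[w wP] (k : nat) : exists w : 'rV[R]_n * 'rV[R]_(n + n),
    [/\ enorm (w.1 - x) < k.+1%:R^-1, enorm w.2 <= L + 1,
        reg_hessian G w.1 (rsubmx w.2) (lsubmx w.2),
        enorm (rsubmx w.2) = 1 & dot (lsubmx w.2) (rsubmx w.2) < k.+1%:R^-1].
  apply: contrapT => none; apply: noncoer.
  exists k.+1%:R^-1, (Num.min r k.+1%:R^-1); split => //.
  - by rewrite lt_min r0 e_gt0.
  - by rewrite ge_min lexx.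
  move=> y u z; rewrite lt_min => /andP[yr yk] nzu.
  rewrite leNgt; apply/negP => zu; apply: none.
  have u_neq0 : u != 0.
    by apply: contraTneq zu => ->; rewrite !dot0r mulr0 ltxx.
  have u0 := enorm_gt0 _ u_neq0.
  set a := (enorm u)^-1; have a0 : 0 < a by rewrite invr_gt0.
  have Nu : enorm (a *: u) = 1 by rewrite enormZ gtr0_norm // mulVf // gt_eqF.
  have nzu' := reg_hessianZ _ _ _ _ _ a0 nzu.
  have Nz := reg_hessian_le _ _ _ _ _ _ _ L0 lipG yr nzu'.
  exists (y, row_mx (a *: z) (a *: u)); rewrite /= row_mxKl row_mxKr; split => //.
    apply: le_trans (enorm_row_mx_le _ _) _; rewrite Nu in Nz *; lra.
  rewrite !dotE mulrA -expr2 exprVn mulrC ltr_pdivrMr ?exprn_gt0 //.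
  by rewrite sqr_enorm.
have [p pP] := bounded_cluster (snd \o w) (L + 1)
  (fun k => let: And5 _ h _ _ _ := wP k in h).
have near_p (e : R) : 0 < e -> exists y u z, [/\ enorm (y - x) < e,
    enorm (u - rsubmx p) < e, enorm (z - lsubmx p) < e, reg_hessian G y u z &
    enorm u = 1 /\ dot z u < e].
  move=> e0; have [N NP] := invS_lt e e0; have [k Nk kp] := pP e e0 N.
  have [wx _ nw u1 zu] := wP k.
  exists (w k).1, (rsubmx (w k).2), (lsubmx (w k).2); split => //.
  - exact: lt_trans wx (NP _ Nk).
  - apply: le_lt_trans kp; rewrite /= -linearB /= -[X in _ <= enorm X]hsubmxK.
    exact: enorm_row_mx_r.
  - apply: le_lt_trans kp; rewrite /= -linearB /= -[X in _ <= enorm X]hsubmxK.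
    exact: enorm_row_mx_l.
  - by split => //; exact: lt_trans zu (NP _ Nk).
have /pd/(_ _)/= : rsubmx p != 0.
  apply/eqP => p0; have [//|y [u [z [_ + _ _ [u1 _]]]]] := near_p 1.
  by rewrite p0 subr0 u1 ltxx.
move=> /(_ (lsubmx p)) zu0.
have /zu0 : gen_hessian G x (rsubmx p) (lsubmx p).
  apply/(gen_hessianP _ _ _ _ cG) => e /near_p[y [u [z [? ? ? ? _]]]].
  by exists y, u, z.
set c := dot _ _ => c0.
have c2 : 0 < c / 2 by rewrite divr_gt0.
have [d d0 dP] := dot_near (lsubmx p) (rsubmx p) _ c2.
have [|y [u [z [_ up zp _ [_ zu]]]]] := near_p (Num.min d (c / 2)).
  by rewrite lt_min d0.
move: up zp zu; rewrite !lt_min => /andP[ud _] /andP[zd _] /andP[_ zu].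
have := dP _ _ zd ud; rewrite -/c ltr_norml => /andP[+ _]; lra.
Qed.

(** * From coercive coderivatives to strong monotonicity *)

Lemma enorm_segment_le {R : realType} {n} (x a b : 'rV[R]_n) (t : R) :
  0 <= t <= 1 ->
  enorm (a + t *: (b - a) - x) <= Num.max (enorm (a - x)) (enorm (b - x)).
Proof.
move=> /andP[t0 t1].
have -> : a + t *: (b - a) - x = (1 - t) *: (a - x) + t *: (b - x).
  by apply/rowP => i; rewrite !mxE; ring.
apply: le_trans (enormD _ _) _; rewrite !enormZ !ger0_norm ?subr_ge0 //.
set M := Num.max _ _.
have aM : enorm (a - x) <= M by rewrite le_max lexx.
have bM : enorm (b - x) <= M by rewrite le_max lexx orbT.
nra.
Qed.

(* A fuzzy mean value inequality for [f = - dot w (G _)] along [w = b - a]: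
   the penalised function [f y - t * s + K |y - a - t w|^2] of [(t, y)] attains
   its minimum at some [t < 1], where it yields a proximal subgradient [v] of
   [f] at [y] with [s <= dot v w]. *)
Lemma coercive_strongly_monotone {R : realType} {n} (G : 'rV[R]_n -> 'rV[R]_n)
    (x : 'rV[R]_n) (r L k : R) :
  continuous G -> 0 < r -> 0 < L -> lipschitz_near G x r L ->
  (forall y u z, enorm (y - x) < r -> reg_hessian G y u z -> k * dot u u <= dot z u) ->
  forall a b, enorm (a - x) < r / 2 -> enorm (b - x) < r / 2 ->
    k * dot (b - a) (b - a) <= dot (G b - G a) (b - a).
Proof.
move=> cG r0 L0 lipG coer a b ar br.
have [w wE] : exists w, w = b - a by exists (b - a).
rewrite -wE leNgt; apply/negP; set m := dot (G b - G a) w => mk.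
(* The midpoint of [- k |w|^2] and [- m = f b - f a]: strictly below the increment of [f], yet
   strictly above the bound that coercivity puts on [<v, w>]. *)
set s := - (m + k * dot w w) / 2.
set f := fun y => - dot w (G y).
have mE : m = dot w (G b) - dot w (G a) by rewrite /m dotDl dotNl !(dotC w).
have del0 : 0 < f b - f a - s by rewrite /f /s; lra.
set del := f b - f a - s in del0.
set A := L * enorm w; have A0 : 0 <= A by rewrite mulr_ge0 ?enorm_ge0 ?ltW.
have fL y z : enorm (y - x) < r -> enorm (z - x) < r ->
    f y - f z <= A * enorm (y - z).
  move=> yr zr; have -> : f y - f z = dot w (G z - G y) by rewrite /f !dotE; ring.
  apply: le_trans (dot_le_enorm _ _) _; rewrite /A mulrC mulrAC ler_wpM2r ?enorm_ge0 //.
  by rewrite (enormB y); apply: lipG.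
set C := A * (2 * r) + `|s|.
have C0 : 0 <= C by rewrite addr_ge0 // mulr_ge0 // mulr_ge0 // ltW.
(* The term with [del] excludes a minimiser at [t = 1]; the term with [r] keeps [y] within [r / 4]
   of the segment, hence inside the ball. *)
set K := 1 + A ^+ 2 / del + C * 16 / r ^+ 2.
have K1 : 0 <= A ^+ 2 / del by rewrite divr_ge0 ?sqr_ge0 // ltW.
have K2 : 0 <= C * 16 / r ^+ 2 by rewrite divr_ge0 ?sqr_ge0 // mulr_ge0.
have K0 : 0 < K by rewrite /K; lra.
have Kdel : A ^+ 2 < K * del.
  by rewrite -ltr_pdivrMr // /K; lra.
have KC : C * 16 < K * r ^+ 2.
  by rewrite -ltr_pdivrMr ?exprn_gt0 // /K; lra.
clearbody K.
pose q (ty : R * 'rV[R]_n) := ty.2 - a - ty.1 *: w.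
pose F ty := f ty.2 - ty.1 * s + K * dot (q ty) (q ty).
have cF : continuous F.
  have cq : continuous q.
    apply: continuous_sub; first apply: continuous_sub.
    - by move=> ty; exact: cvg_snd.
    - exact: continuous_cst.
    - by move=> ty; apply: cvgZ; [exact: cvg_fst|exact: cvg_cst].
  have cf : continuous (fun ty : R * 'rV[R]_n => dot w (G ty.2)).
    apply: continuous_dot; first exact: continuous_cst.
    by move=> ty; apply: (continuous_comp (f := snd)); [exact: cvg_snd|exact: cG].
  move=> ty; apply: cvgD; first apply: cvgB.
  - by apply: cvgN; exact: cf.
  - by apply: cvgM; [exact: cvg_fst|exact: cvg_cst].
  - by apply: cvgM; [exact: cvg_cst|exact: (continuous_dot _ _ cq cq)].
have [||[t y]] := @compact_EVT_min _ R F (`[0, 1]%classic `*` cball x (r * 3 / 4)) _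
    (compact_setX (@segment_compact R 0 1) (compact_cball _ _)).
- by exists (0, x); split; rewrite /cball /= ?in_itv /= ?ler01 ?lexx // subrr enorm0; lra.
- exact: continuous_subspaceT.
rewrite inE /= in_itv /= => -[/andP[t0 t1] yx] minF.
have {}yx : enorm (y - x) <= r * 3 / 4 := yx.
have {}minF t' y' : 0 <= t' <= 1 -> enorm (y' - x) <= r * 3 / 4 -> F (t, y) <= F (t', y').
  by move=> ? ?; apply: minF; rewrite inE /=; split; rewrite //= in_itv.
have aw : enorm (a + t *: w - x) < r / 2.
  by rewrite wE (le_lt_trans (enorm_segment_le _ _ _ _ _)) ?t0 // gt_max ar.
(* Comparison with the point [(0, a)], where the penalty vanishes. *)
have qE : enorm (y - a - t *: w) ^+ 2 * K <= f a - f y + t * s.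
  have := minF 0 a; rewrite /F /q /= mul0r subr0 scale0r subr0 subrr dot0l mulr0 addr0.
  rewrite lexx ler01 => /(_ isT) h.
  have /h : enorm (a - x) <= r * 3 / 4 by lra.
  rewrite sqr_enorm; lra.
have yr : enorm (y - x) < r by lra.
have ya : enorm (y - a) <= 2 * r.
  by have := enorm_dist x y a; rewrite (enormB x a); lra.
have qr : enorm (y - a - t *: w) < r / 4.
  have ts : t * s <= `|s|.
    apply: le_trans (ler_norm _) _; rewrite normrM (ger0_norm t0).
    by rewrite ler_piMl.
  have : f a - f y <= A * (2 * r).
    apply: le_trans (fL _ _ _ yr) _; first by lra.
    by rewrite enormB ler_wpM2l.
  move=> fay; have : enorm (y - a - t *: w) ^+ 2 * K <= C by rewrite /C; lra.
  move=> h; rewrite -(@ltr_pXn2r _ 2) ?nnegrE ?enorm_ge0 ?divr_ge0 ?ltW //.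
  rewrite -(ltr_pM2r K0); apply: le_lt_trans h _.
  rewrite expr_div_n; lra.
(* At [t = 1], with [e = |y - b|], the comparison reads [K e^2 + del <= A e], which is impossible
   because [A^2 < K del] makes the discriminant negative. *)
have t_lt1 : t < 1.
  rewrite lt_neqAle t1 andbT; apply/eqP => t_eq1; move: qE.
  rewrite t_eq1 scale1r mul1r wE opprB addrA subrK => qE.
  have := fL b y _ yr; rewrite (enormB b y); have -> : enorm (b - x) < r by lra.
  move=> /(_ isT) fby; move: qE fby Kdel; set e := enorm (y - b).
  have e0 : 0 <= e := enorm_ge0 _.
  rewrite /del => *; have := sqr_ge0 (2 * K * e - A); nra.
have [p pE] : exists p, p = y - a - t *: w by exists (y - a - t *: w).
rewrite -pE in qr.
have ysmall : enorm (y - x) < r * 3 / 4.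
  have -> : y - x = p + (a + t *: w - x).
    by rewrite pE; apply/rowP => i; rewrite !mxE; ring.
  by have := enormD p (a + t *: w - x); lra.
set v := - (2 * K) *: p.
(* Minimality in [y] with [t] fixed: expanding the penalty around [p] gives the proximal inequality
   for [v], the minimiser being interior to the ball. *)
have nv : reg_hessian G y (- w) v.
  apply: (@proximal_reg_hessian _ _ _ _ _ _ (r * 3 / 4 - enorm (y - x)) K).
  - by lra.
  - exact: ltW.
  move=> y' y'y; have y'x : enorm (y' - x) <= r * 3 / 4.
    by have := enorm_dist y y' x; lra.
  have := minF t y'; rewrite t0 t1 => /(_ isT y'x); rewrite /F /q /=.
  have -> : y' - a - t *: w = (y' - y) + p.
    by rewrite pE; apply/rowP => i; rewrite !mxE; ring.
  rewrite -pE; have := mulr_ge0 (ltW K0) (sqr_ge0 (enorm (G y' - G y))).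
  rewrite /v /f (sqr_enorm (y' - y)).
  move: (y' - y) => h; rewrite !dotE (dotC p h); lra.
have := coer _ _ _ yr nv; rewrite !dotNr dotNl opprK => vw.
(* Minimality in [t] with [y] fixed: increasing [t] by a small [h], possible since [t < 1], gives
   [s <= <v, w> + h K |w|^2]. *)
have sv : s <= dot v w.
  apply/ler_addgt0Pr => e e0.
  have N0 : 0 < 1 + K * dot w w.
    have := mulr_ge0 (ltW K0) (dot_ge0 w); lra.
  set h := Num.min (1 - t) (e / (1 + K * dot w w)).
  have h0 : 0 < h by rewrite lt_min subr_gt0 t_lt1 divr_gt0.
  have ht : h <= 1 - t by rewrite ge_min lexx.
  have he : h * (1 + K * dot w w) <= e.
    by rewrite -ler_pdivlMr // ge_min lexx orbT.
  have th : 0 <= t + h <= 1 by apply/andP; split; lra.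
  have := minF (t + h) y th yx; rewrite /F /q /=.
  have -> : y - a - (t + h) *: w = p - h *: w.
    by rewrite pE; apply/rowP => i; rewrite !mxE; ring.
  rewrite -pE /v !dotE (dotC w p) => H.
  rewrite -(ler_pM2l h0); nra.
by move: mk vw sv; rewrite /s; lra.
Qed.

(** * Existence of Newton directions *)

Lemma strongly_monotone_dist {R : realType} {n} (G : 'rV[R]_n -> 'rV[R]_n)
    (a b : 'rV[R]_n) (k : R) :
  k * dot (b - a) (b - a) <= dot (G b - G a) (b - a) ->
  k * enorm (b - a) <= enorm (G b - G a).
Proof.
move=> mono; have [->|ab] := eqVneq (b - a) 0.
  by rewrite enorm0 mulr0 enorm_ge0.
rewrite -(ler_pM2r (enorm_gt0 _ ab)) -mulrA -expr2 sqr_enorm.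
by apply: le_trans mono _; exact: dot_le_enorm.
Qed.

(* Minimising [K |G y - G x|^2 - dot v y] for large [K] produces regular
   coderivatives [v] in the directions [2 K (G y - G x)]; these stay bounded
   because [G] is locally bi-Lipschitz. *)
Lemma reg_hessian_surjective {R : realType} {n} (G : 'rV[R]_n -> 'rV[R]_n)
    (x v : 'rV[R]_n) (r L k : R) :
  continuous G -> 0 < r -> 0 < L -> 0 < k -> lipschitz_near G x r L ->
  (forall a b, enorm (a - x) < r -> enorm (b - x) < r ->
    k * dot (b - a) (b - a) <= dot (G b - G a) (b - a)) ->
  forall e : R, 0 < e -> exists y d, [/\ enorm (y - x) < e,
    enorm d <= 2 * L * enorm v / k ^+ 2 & reg_hessian G y d v].
Proof.
move=> cG r0 L0 k0 lipG mono e e0.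
have [s s0 [se sr]] : exists2 s : R, 0 < s & s <= e /\ s <= r / 2.
  exists (Num.min e (r / 2)); first by rewrite lt_min e0 divr_gt0.
  by rewrite !ge_min !lexx orbT.
have v0 := enorm_ge0 v.
have k2 : 0 < k ^+ 2 by rewrite exprn_gt0.
(* Comparing the minimiser with [x] will give [K k^2 |y - x| <= |v|], so this [K] forces
   [|y - x| < s] and the minimiser is interior. *)
have [K K0 Kv] : exists2 K : R, 0 < K & enorm v < K * k ^+ 2 * s.
  exists ((1 + enorm v) / (k ^+ 2 * s)).
    by rewrite divr_gt0 // ?mulr_gt0 //; lra.
  rewrite -mulrA divfK; first by lra.
  by rewrite gt_eqF // mulr_gt0.
pose F y := K * dot (G y - G x) (G y - G x) - dot v y.
have cF : continuous F.
  have cGx : continuous (fun y => G y - G x).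
    by apply: continuous_sub; [exact: cG|exact: continuous_cst].
  apply: (@continuous_sub R R^o).
    by apply: continuous_mull; exact: continuous_dot.
  by apply: continuous_dot; [exact: continuous_cst|exact: continuous_id].
have [y yx minF] := cball_argmin F x s (ltW s0) cF.
have yr : enorm (y - x) < r by lra.
have xr : enorm (x - x) < r by rewrite subrr enorm0.
have Ky : K * k ^+ 2 * enorm (y - x) <= enorm v.
  have [->|yx_neq0] := eqVneq (y - x) 0; first by rewrite enorm0 mulr0.
  rewrite -(ler_pM2r (enorm_gt0 _ yx_neq0)).
  have := minF x; rewrite subrr enorm0 ltW // => /(_ isT).
  rewrite /F subrr dot0l mulr0 sub0r -sqr_enorm => H.
  have vy : dot v y - dot v x <= enorm v * enorm (y - x).
    by have := dot_le_enorm v (y - x); rewrite dotDr dotNr.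
  have H2 : (k * enorm (y - x)) ^+ 2 <= enorm (G y - G x) ^+ 2.
    rewrite lerXn2r ?nnegrE ?mulr_ge0 ?enorm_ge0 ?(ltW k0) //.
    exact: (strongly_monotone_dist G _ _ _ (mono _ _ xr yr)).
  have {H2} := ler_wpM2l (ltW K0) H2; rewrite exprMn => H2.
  lra.
have ys : enorm (y - x) < s.
  rewrite -(@ltr_pM2l _ (K * k ^+ 2)) ?mulr_gt0 //; lra.
(* The same estimate bounds [2 K |G y - G x| <= 2 K L |y - x|] independently of [K]. *)
exists y, ((2 * K) *: (G y - G x)); split; first by lra.
  rewrite enormZ gtr0_norm ?mulr_gt0 // ler_pdivlMr //.
  have Gyx := lipG _ _ yr xr.
  apply: (@le_trans _ _ (2 * K * (L * enorm (y - x)) * k ^+ 2)).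
    by rewrite ler_wpM2r ?(ltW k2) // ler_wpM2l // mulr_ge0 // ltW.
  have := ler_wpM2l (ltW L0) Ky; lra.
apply: (@proximal_reg_hessian _ _ _ _ _ _ (s - enorm (y - x)) K).
- by lra.
- exact: ltW.
move=> y' y'y; have y'x : enorm (y' - x) <= s by have := enorm_dist y y' x; lra.
have := minF y' y'x; rewrite /F.
have -> : G y' - G x = (G y' - G y) + (G y - G x) by rewrite addrA subrK.
have := mulr_ge0 (ltW K0) (sqr_ge0 (enorm (y' - y))).
rewrite (sqr_enorm (G y' - G y)) mulrDr (dotDr v y').
move: (G y' - G y) (G y - G x) => g h.
rewrite dotNr !dotDl !dotDr !dotZl (dotC h g); lra.
Qed.

(** The value [v] is exact along the approximation, so only the bounded directions need a cluster
    point. *)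
Lemma gen_hessian_surjective {R : realType} {n} (G : 'rV[R]_n -> 'rV[R]_n)
    (x v : 'rV[R]_n) (r L k : R) :
  continuous G -> 0 < r -> 0 < L -> 0 < k -> lipschitz_near G x r L ->
  (forall a b, enorm (a - x) < r -> enorm (b - x) < r ->
    k * dot (b - a) (b - a) <= dot (G b - G a) (b - a)) ->
  exists d, gen_hessian G x d v.
Proof.
move=> cG r0 L0 k0 lipG mono.
have e_gt0 i : 0 < i.+1%:R^-1 :> R by rewrite invr_gt0.
have /choice[w wP] (i : nat) : exists w : 'rV[R]_n * 'rV[R]_n,
    [/\ enorm (w.1 - x) < i.+1%:R^-1, enorm w.2 <= 2 * L * enorm v / k ^+ 2 &
        reg_hessian G w.1 w.2 v].
  have [y [d ?]] := reg_hessian_surjective G x v r L k cG r0 L0 k0 lipG mono _ (e_gt0 i).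
  by exists (y, d).
have [d dP] := bounded_cluster (snd \o w) _ (fun i => let: And3 _ h _ := wP i in h).
exists d; apply/(gen_hessianP _ _ _ _ cG) => e e0.
have [N NP] := invS_lt e e0.
have [i Ni id] := dP e e0 N; have [wx _ nw] := wP i.
exists (w i).1, (w i).2, v; split => //; last by rewrite subrr enorm0.
exact: lt_trans wx (NP i Ni).
Qed.

(** * Mean value theorem and quadratic upper bound *)

Lemma derive_along_line {R : realType} {n} (phi : 'rV[R]_n -> R)
    (G : 'rV[R]_n -> 'rV[R]_n) (y h : 'rV[R]_n) (t : R) :
  C11_with_gradient phi G ->
  is_derive t 1 (fun s : R => phi (y + s *: h)) (dot (G (y + t *: h)) h).
Proof.
move=> [/(_ (y + t *: h))[dphi dE] _].
have dvb : derivable phi (y + t *: h) h by exact: diff_derivable.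
have := deriveE h dphi; rewrite dE => DE.
have eqf : (fun s : R => s^-1 *: (phi (y + (s *: 1 + t) *: h) - phi (y + t *: h))) =
    (fun s : R => s^-1 *: (phi (s *: h + (y + t *: h)) - phi (y + t *: h))).
  apply/funext => s; congr (_ *: (phi _ - _)).
  by rewrite [s *: 1]mulr1 scalerDl addrCA.
split; first by rewrite /derivable /= eqf.
by rewrite /derive /= eqf -DE.
Qed.

Lemma mean_value {R : realType} {n} (phi : 'rV[R]_n -> R)
    (G : 'rV[R]_n -> 'rV[R]_n) (y h : 'rV[R]_n) :
  C11_with_gradient phi G ->
  exists2 t : R, 0 <= t <= 1 & phi (y + h) - phi y = dot (G (y + t *: h)) h.
Proof.
move=> C11; have dg t := derive_along_line _ _ y h t C11.
have [|t t01] := @MVT_segment R (fun s => phi (y + s *: h))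
  (fun t => dot (G (y + t *: h)) h) 0 1 ler01 (fun t _ => dg t).
  apply: continuous_subspaceT => t; apply: differentiable_continuous.
  by apply/derivable1_diffP; case: (dg t).
by rewrite scale1r scale0r addr0 subr0 mulr1 => ->; exists t; rewrite // -in_itv.
Qed.

(** The mean value theorem turns the remainder into [<G (y + t h) - G y, h>] with [h = z - y], which
    the Lipschitz bound controls; this gives the constant [L] rather than the sharper [L / 2]. *)
Lemma C11_taylor {R : realType} {n} (phi : 'rV[R]_n -> R)
    (G : 'rV[R]_n -> 'rV[R]_n) (x : 'rV[R]_n) :
  C11_with_gradient phi G ->
  exists r L : R, [/\ 0 < r, 0 < L, lipschitz_near G x r L &
    forall y z, enorm (y - x) < r -> enorm (z - x) < r ->
      phi z <= phi y + dot (G y) (z - y) + L * dot (z - y) (z - y)].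
Proof.
move=> C11; have [_ [_ /(_ x)[r [r0 [L lipG]]]]] := C11.
have lipG' : lipschitz_near G x r (`|L| + 1).
  move=> y z yr zr; apply: le_trans (lipG _ _ yr zr) _.
  by rewrite ler_wpM2r ?enorm_ge0 // (le_trans (ler_norm L)) // lerDl.
exists r, (`|L| + 1); split => //.
move=> y z yr zr; have [t t01] := mean_value _ _ y (z - y) C11.
have yt : enorm (y + t *: (z - y) - x) < r.
  by rewrite (le_lt_trans (enorm_segment_le _ _ _ _ t01)) // gt_max yr.
rewrite [y + (z - y)]addrC subrK => /eqP; rewrite subr_eq addrC => /eqP ->.
rewrite -addrA lerD2l -lerBlDl -dotNl -dotDl -sqr_enorm.
apply: le_trans (dot_le_enorm _ _) _; rewrite expr2 mulrA ler_wpM2r ?enorm_ge0 //.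
apply: le_trans (lipG' _ _ yt yr) _; rewrite ler_wpM2l ?addr_ge0 //.
have /andP[t0 t1] := t01.
by rewrite addrC addKr enormZ ger0_norm // ler_piMl ?enorm_ge0.
Qed.

(** * Newton directions, backtracking and decrease *)

Lemma newton_direction_descent {R : realType} {n} (phi : 'rV[R]_n -> R)
    (G : 'rV[R]_n -> 'rV[R]_n) (x d : 'rV[R]_n) :
  C11_with_gradient phi G -> hessian_posdef G x -> G x != 0 ->
  gen_hessian G x d (- G x) -> dot (G x) d < 0.
Proof.
move=> C11 pd Gx dx; have [_ [cG _]] := C11.
have [r [L [r0 L0 lipG _]]] := C11_taylor _ _ x C11.
have xr : enorm (x - x) < r by rewrite subrr enorm0.
have := gen_hessian_le _ _ _ _ _ _ _ cG L0 lipG xr dx; rewrite enormN => GL.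
(* Positive definiteness applies only to [d != 0]; [|G x| <= L |d|] with [G x != 0] rules out
   [d = 0]. *)
suff /pd/(_ dx) : d != 0 by rewrite dotNl oppr_gt0.
apply: contraTneq GL => ->; rewrite enorm0 mulr0 -ltNge; exact: enorm_gt0.
Qed.

Lemma armijo_exists {R : realType} {n} (phi : 'rV[R]_n -> R)
    (G : 'rV[R]_n -> 'rV[R]_n) (sigma beta : R) (x d : 'rV[R]_n) :
  C11_with_gradient phi G -> sigma < 1 -> 0 < beta < 1 -> dot (G x) d < 0 ->
  exists j : nat, armijo phi G sigma x d (beta ^+ j).
Proof.
move=> C11 s1 /andP[b0 b1] desc.
have [r [L [r0 L0 lipG tay]]] := C11_taylor _ _ x C11.
have xr : enorm (x - x) < r by rewrite subrr enorm0.
have d0 := enorm_ge0 d; have dd := dot_ge0 d.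
have d1 : 0 < enorm d + 1 by lra.
have Ld : 0 < L * dot d d + 1 by rewrite ltr_wpDl // mulr_ge0 // ltW.
have b1' : `|beta| < 1 by rewrite gtr0_norm.
(* The first threshold keeps the trial point in the ball of the quadratic bound; the second absorbs
   the quadratic term into the slack [(1 - sigma) * - dot (G x) d]. *)
have /cvgrPdist_lt/(_ (Num.min (r / (enorm d + 1))
    ((1 - sigma) * - dot (G x) d / (L * dot d d + 1)))) := cvg_expr b1'.
rewrite lt_min !divr_gt0 // ?mulr_gt0 ?subr_gt0 ?oppr_gt0 // => /(_ isT)[j _ /(_ j)].
move=> /(_ (leqnn _)); have bj : 0 < beta ^+ j by rewrite exprn_gt0.
rewrite /= sub0r normrN gtr0_norm // lt_min !ltr_pdivlMr // => /andP[bd bL].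
have xd : x + beta ^+ j *: d - x = beta ^+ j *: d by rewrite addrAC subrr add0r.
exists j; rewrite /armijo; apply: le_trans (tay x _ xr _) _; rewrite xd.
  by rewrite enormZ gtr0_norm //; lra.
rewrite !dotE; nra.
Qed.

Lemma gdna_step_le {R : realType} {n} (phi : 'rV[R]_n -> R)
    (G : 'rV[R]_n -> 'rV[R]_n) (sigma beta : R) (x x' : 'rV[R]_n) :
  C11_with_gradient phi G -> 0 < sigma -> 0 < beta -> hessian_posdef G x ->
  gdna_step phi G sigma beta x x' -> phi x' <= phi x.
Proof.
move=> C11 s0 b0 pd [Gx [d [dx [j [arm [_ ->]]]]]].
have := newton_direction_descent _ _ _ _ C11 pd Gx dx => desc.
apply: le_trans arm _; rewrite gerDl; apply: ltW.
by rewrite pmulr_rlt0 // mulr_gt0 // exprn_gt0.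
Qed.

Lemma C11_continuous {R : realType} {n} (phi : 'rV[R]_n -> R)
    (G : 'rV[R]_n -> 'rV[R]_n) :
  C11_with_gradient phi G -> continuous phi.
Proof. by move=> [dphi _] x; apply: differentiable_continuous; case: (dphi x). Qed.

(** Collects the local estimates on one ball. Its radius is half of that for coercivity, since
    strong monotonicity is derived only there. *)
Lemma posdef_local {R : realType} {n} (phi : 'rV[R]_n -> R)
    (G : 'rV[R]_n -> 'rV[R]_n) (x : 'rV[R]_n) :
  C11_with_gradient phi G -> hessian_posdef G x ->
  exists r L k : R, [/\ 0 < r, 0 < L & 0 < k] /\
  [/\ lipschitz_near G x r L,
    forall y z, enorm (y - x) < r -> enorm (z - x) < r ->
      phi z <= phi y + dot (G y) (z - y) + L * dot (z - y) (z - y),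
    forall y u z, enorm (y - x) < r -> gen_hessian G y u z -> k * dot u u <= dot z u &
    forall a b, enorm (a - x) < r -> enorm (b - x) < r ->
      k * dot (b - a) (b - a) <= dot (G b - G a) (b - a)].
Proof.
move=> C11 pd; have [_ [cG _]] := C11.
have [r [L [r0 L0 lipG tay]]] := C11_taylor _ _ x C11.
have [k [r' [k0 r'0 r'r coer]]] := posdef_coercive _ _ _ _ cG r0 L0 lipG pd.
have lipG' : lipschitz_near G x r' L by move=> y z ? ?; apply: lipG; lra.
exists (r' / 2), L, k; split; first by split => //; rewrite divr_gt0.
split=> [y z ? ?|y z ? ?|y u z ? |].
- by apply: lipG; lra.
- by apply: tay; lra.
- by apply: (gen_hessian_coercive _ x _ _ _ r') => //; lra.
- exact: (coercive_strongly_monotone _ _ _ _ _ cG r'0 L0 lipG' coer).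
Qed.

(* Near a non-stationary point the Newton directions are bounded above and away
   from zero, so the backtracking stops at a step length bounded below. *)
Lemma gdna_uniform_decrease {R : realType} {n} (phi : 'rV[R]_n -> R)
    (G : 'rV[R]_n -> 'rV[R]_n) (sigma beta : R) (x : 'rV[R]_n) :
  C11_with_gradient phi G -> 0 < sigma < 1 / 2 -> 0 < beta < 1 ->
  hessian_posdef G x -> G x != 0 ->
  exists c e : R, [/\ 0 < c, 0 < e & forall y y', enorm (y - x) < e ->
    gdna_step phi G sigma beta y y' -> phi y' <= phi y - c].
Proof.
move=> C11 /andP[s0 s2] /andP[b0 b1] pd Gx; have [_ [cG _]] := C11.
have [r [L [k [[r0 L0 k0] [lipG tay coer _]]]]] := posdef_local _ _ _ C11 pd.
have g0 := enorm_gt0 _ Gx; set g := enorm (G x) in g0.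
have xr : enorm (x - x) < r by rewrite subrr enorm0.
(* Lower bound on the accepted step. Either the first trial is accepted, or the previous one failed:
   failing Armijo inside the ball forces it above [k / (2 L)], using [sigma < 1 / 2], and reaching
   length [r / 2] with [|d| <= 2 g / k] forces it to be at least [r k / (4 g)]. *)
have [tm tm0 [tm1 tmL tmr]] : exists2 tm : R, 0 < tm & [/\ tm <= 1,
    tm <= beta * (k / (2 * L)) & tm <= beta * (r * k / (4 * g))].
  exists (Num.min 1 (Num.min (beta * (k / (2 * L))) (beta * (r * k / (4 * g))))).
    by rewrite !lt_min ltr01 !mulr_gt0 // invr_gt0 mulr_gt0.
  by rewrite !ge_min !lexx !orbT.
set D0 := k * (g / (2 * L)) ^+ 2.
have D00 : 0 < D0 by rewrite mulr_gt0 // exprn_gt0 // divr_gt0 // mulr_gt0.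
(* The radius [g / (2 L)] keeps [|G y|] between [g / 2] and [2 g]; then [|d| >= g / (2 L)], so [D0]
   bounds [- dot (G y) d] from below. *)
exists (sigma * (tm * D0)), (Num.min (r / 2) (g / (2 * L))); split.
- by rewrite mulr_gt0 // mulr_gt0.
- by rewrite lt_min !divr_gt0 // mulr_gt0.
move=> y y'; rewrite lt_min !ltr_pdivlMr ?mulr_gt0 // => /andP[yx ygL].
move=> [Gy [d [dy [j [arm [narm ->]]]]]].
have yr : enorm (y - x) < r by lra.
have GyL := gen_hessian_le _ _ _ _ _ _ _ cG L0 lipG yr dy; rewrite enormN in GyL.
have := coer _ _ _ yr dy; rewrite dotNl -sqr_enorm; set D := - dot (G y) d => kD.
have lip := lipG _ _ yr xr.
have Gy_lo : g <= 2 * enorm (G y).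
  have := enormD (G x - G y) (G y); rewrite subrK (enormB (G x)) -/g; lra.
have Gy_hi : enorm (G y) <= 2 * g.
  have := enormD (G y - G x) (G x); rewrite subrK -/g; lra.
have d_lo : g / (2 * L) <= enorm d by rewrite ler_pdivrMr ?mulr_gt0 //; lra.
have d0 : 0 < enorm d by apply: lt_le_trans d_lo; rewrite divr_gt0 // mulr_gt0.
have D0D : D0 <= D.
  apply: le_trans kD; rewrite ler_pM2l // lerXn2r ?nnegrE ?enorm_ge0 //.
  by rewrite ltW // divr_gt0 // mulr_gt0.
have Dpos : 0 < D by lra.
have d_hi : k * enorm d <= 2 * g.
  have : D <= enorm (G y) * enorm d by rewrite /D -dotNl -(enormN (G y)) dot_le_enorm.
  move=> DG; rewrite -(ler_pM2r d0); nra.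
have tmj : tm <= beta ^+ j.
  case: j arm narm => [|j] _ narm; first by rewrite expr0.
  have bj : 0 < beta ^+ j by rewrite exprn_gt0.
  have [far|near] := leP (r / 2) (beta ^+ j * enorm d).
    apply: le_trans tmr _; rewrite exprS ler_pM2l // ler_pdivrMr ?mulr_gt0 //.
    nra.
  apply: le_trans tmL _; rewrite exprS ler_pM2l // ler_pdivrMr ?mulr_gt0 //.
  have /negP := narm j (ltnSn j); rewrite -ltNge.
  have yd : y + beta ^+ j *: d - y = beta ^+ j *: d by rewrite addrAC subrr add0r.
  have ydx : enorm (y + beta ^+ j *: d - x) < r.
    have := enorm_dist y (y + beta ^+ j *: d) x.
    by rewrite yd enormZ (gtr0_norm bj); lra.
  have := tay _ _ yr ydx; rewrite yd !dotE -sqr_enorm.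
  have -> : dot (G y) d = - D by rewrite opprK.
  move=> h1 h2.
  have h3 : beta ^+ j * ((1 - sigma) * D) < beta ^+ j * (L * beta ^+ j * enorm d ^+ 2).
    lra.
  rewrite ltr_pM2l // in h3.
  have h4 : k * ((1 - sigma) * D) < L * beta ^+ j * D.
    apply: (@lt_le_trans _ _ (k * (L * beta ^+ j * enorm d ^+ 2))).
      by rewrite ltr_pM2l.
    rewrite mulrCA ler_pM2l ?mulr_gt0 //.
  rewrite mulrA ltr_pM2r // in h4; nra.
apply: le_trans arm _.
have -> : dot (G y) d = - D by rewrite opprK.
rewrite mulrN lerD2l lerN2 -mulrA ler_pM2l //.
by rewrite ler_pM // ltW.
Qed.

(** * Limiting points and tilt stability *)

Lemma limiting_point_near {R : realType} {n} (x : nat -> 'rV[R]_n) (xbar : 'rV[R]_n) :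
  limiting_point x xbar ->
  forall e : R, 0 < e -> forall N, exists2 k, (N <= k)%N & enorm (x k - xbar) < e.
Proof.
move=> [p [pinc /cvg_enormP cx]] e e0 N; have [N' N'P] := cx e e0.
have p_ge k : (k <= p k)%N by elim: k => // k /leq_ltn_trans; apply; exact: pinc.
exists (p (maxn N N')); first by rewrite (leq_trans _ (p_ge _)) // leq_maxl.
by apply: N'P; rewrite leq_maxr.
Qed.

(** The segment from [x] to [y] stays in the convex ball. Minimality and the quadratic bound give [0
    <= t <G x - v, y - x> + t^2 L |y - x|^2] for small [t > 0]; divide by [t] and let it shrink. *)
Lemma argmin_variational {R : realType} {n} (phi : 'rV[R]_n -> R)
    (G : 'rV[R]_n -> 'rV[R]_n) (xbar v x y : 'rV[R]_n) (g : R) :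
  C11_with_gradient phi G -> M_tilt phi xbar g v x -> cball xbar g y ->
  0 <= dot (G x - v) (y - x).
Proof.
move=> C11 [xg minx] yg.
have [r [L [r0 L0 _ tay]]] := C11_taylor _ _ x C11.
have xr : enorm (x - x) < r by rewrite subrr enorm0.
apply/ler_addgt0Pr => e e0.
have [h hE] : exists h, h = y - x by exists (y - x).
rewrite -hE; have h0 := enorm_ge0 h; have hh := dot_ge0 h.
have h1 : 0 < enorm h + 1 by lra.
have Lh : 0 < L * dot h h + 1 by rewrite ltr_wpDl // mulr_ge0 // ltW.
have [t t0 [t1 tr te]] : exists2 t : R, 0 < t &
    [/\ t <= 1, t * (enorm h + 1) <= r & t * (L * dot h h + 1) <= e].
  exists (Num.min 1 (Num.min (r / (enorm h + 1)) (e / (L * dot h h + 1)))).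
    by rewrite !lt_min ltr01 !divr_gt0.
  rewrite -!ler_pdivlMr // !ge_min !lexx !orbT; split=> //.
have xtg : cball xbar g (x + t *: h).
  rewrite /cball /= hE; apply: le_trans (enorm_segment_le _ _ _ _ _) _.
    by rewrite ltW.
  by rewrite ge_max; apply/andP; split.
have xt : x + t *: h - x = t *: h by rewrite addrAC subrr add0r.
have xtr : enorm (x + t *: h - x) < r by rewrite xt enormZ (gtr0_norm t0); lra.
have := minx _ xtg; have := tay _ _ xr xtr; rewrite xt.
rewrite !dotE => tayx minxt; have te' := ler_wpM2l (ltW t0) te.
have tt := sqr_ge0 t; rewrite -(ler_pM2l t0) mulr0; lra.
Qed.

Lemma posdef_stationary_tilt_stable {R : realType} {n} (phi : 'rV[R]_n -> R)
    (G : 'rV[R]_n -> 'rV[R]_n) (x : 'rV[R]_n) :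
  C11_with_gradient phi G -> hessian_posdef G x -> G x = 0 -> tilt_stable phi x.
Proof.
move=> C11 pd Gx; have cphi := C11_continuous _ _ C11.
have [r [L [k [[r0 L0 k0] [_ _ _ mono]]]]] := posdef_local _ _ _ C11 pd.
have g0 : 0 < r / 2 by rewrite divr_gt0.
have gr y : cball x (r / 2) y -> enorm (y - x) < r by rewrite /cball /= => ?; lra.
have xg : cball x (r / 2) x by rewrite /cball /= subrr enorm0 ltW.
have /choice[m mP] v : exists y, M_tilt phi x (r / 2) v y.
  have cv : continuous (fun y => phi y - dot v y).
    apply: (@continuous_sub R R^o); first exact: cphi.
    by apply: continuous_dot; [exact: continuous_cst|exact: continuous_id].
  have [y yx miny] := cball_argmin _ x (r / 2) (ltW g0) cv.
  by exists y; split => //.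
have lipM v w y z : M_tilt phi x (r / 2) v y -> M_tilt phi x (r / 2) w z ->
    enorm (y - z) <= k^-1 * enorm (v - w).
  move=> My Mz.
  have := argmin_variational _ _ _ _ _ _ _ C11 My Mz.1.
  have := argmin_variational _ _ _ _ _ _ _ C11 Mz My.1.
  have := mono _ _ (gr _ Mz.1) (gr _ My.1) => kyz vz vy.
  have {}kyz : k * dot (y - z) (y - z) <= dot (v - w) (y - z).
    move: vy; rewrite -(opprB y z) dotNr; move: (y - z) kyz vz => h.
    rewrite !dotDl !dotNl; lra.
  rewrite ler_pdivlMl //; have [->|yz] := eqVneq (y - z) 0.
    by rewrite enorm0 mulr0 enorm_ge0.
  rewrite -(ler_pM2r (enorm_gt0 _ yz)) -mulrA -expr2 sqr_enorm.
  by apply: le_trans kyz _; exact: dot_le_enorm.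
have M1 v : M_tilt phi x (r / 2) v = [set m v].
  apply/seteqP; split=> [y My|_ ->]; last exact: mP.
  apply/eqP; rewrite -subr_eq0; apply/eqP/enorm_eq0/eqP.
  rewrite eq_le enorm_ge0 andbT; have := lipM _ _ _ _ My (mP v).
  by rewrite subrr enorm0 mulr0.
(* Strong monotonicity between [x] and [m 0] with [G x = 0], against the variational inequality at
   [m 0] tested with [x]. *)
have m0 : m 0 = x.
  apply/eqP; rewrite -subr_eq0; apply/eqP/enorm_eq0/eqP; rewrite -sqrf_eq0 sqr_enorm.
  rewrite eq_le dot_ge0 andbT -(ler_pM2l k0) mulr0.
  apply: le_trans (mono _ _ (gr _ xg) (gr _ (mP 0).1)) _.
  have := argmin_variational _ _ _ _ _ _ _ C11 (mP 0) xg.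
  by rewrite Gx !subr0 -(opprB (m 0)) dotNr oppr_ge0.
(* The estimates hold for every tilt, so the radius [1] of tilts is arbitrary. *)
exists (r / 2); split => //; exists 1, m, k^-1; split => //; split; first by move=> v _.
split; last by rewrite M1 m0.
by move=> v w _ _; apply: lipM.
Qed.

Theorem theorem3p4 (R : realType) (n : nat) (phi : 'rV[R]_n -> R)
    (G : 'rV[R]_n -> 'rV[R]_n) (x0 : 'rV[R]_n) (sigma beta : R) :
  C11_with_gradient phi G ->
  0 < sigma < 1 / 2 -> 0 < beta < 1 ->
  (forall x, phi x <= phi x0 -> hessian_posdef G x) ->
  (* (i) well-definedness and x^k in Omega for every generated iterate *)
  (forall (x : nat -> 'rV[R]_n) (K : nat), x 0%N = x0 ->
     (forall k : nat, (k < K)%N -> gdna_step phi G sigma beta (x k) (x k.+1)) ->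
     (forall k : nat, (k <= K)%N -> phi (x k) <= phi x0) /\
     (G (x K) != 0 ->
        (exists d, gen_hessian G (x K) d (- G (x K))) /\
        (forall d, gen_hessian G (x K) d (- G (x K)) ->
           exists j : nat, armijo phi G sigma (x K) d (beta ^+ j)))) /\
  (* (ii) limiting points of a (non-terminating) generated sequence *)
  (forall x : nat -> 'rV[R]_n, x 0%N = x0 ->
     (forall k : nat, gdna_step phi G sigma beta (x k) (x k.+1)) ->
     forall xbar, limiting_point x xbar -> tilt_stable phi xbar).
Proof.
move=> C11 s01 b01 pd; have [_ [cG _]] := C11.
have [s0 s2] := andP s01; have [b0 b1] := andP b01.
have decr (x : nat -> 'rV[R]_n) K : x 0%N = x0 ->
    (forall k, (k < K)%N -> gdna_step phi G sigma beta (x k) (x k.+1)) ->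
    forall k, (k <= K)%N -> phi (x k) <= phi x0.
  move=> xx0 step; elim=> [|k IH kK]; first by rewrite xx0.
  have xk := IH (ltnW kK); apply: le_trans (xk).
  by apply: (gdna_step_le _ _ _ _ _ _ C11 s0 b0 _ (step k kK)); exact: pd.
split=> [x K xx0 step|x xx0 step xbar xbarP].
  have xK := decr x K xx0 step; split => // GxK; have pdK := pd _ (xK K (leqnn K)).
  split=> [|d dP].
    have [r [L [k [[r0 L0 k0] [lipG _ _ mono]]]]] := posdef_local _ _ _ C11 pdK.
    exact: (gen_hessian_surjective _ _ _ _ _ _ cG r0 L0 k0 lipG mono).
  apply: armijo_exists => //; first by lra.
  exact: (newton_direction_descent _ _ _ _ C11 pdK GxK dP).
have xle k : phi (x k) <= phi x0 by exact: (decr x k xx0 (fun i _ => step i) k (leqnn k)).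
have xS k : phi (x k.+1) <= phi (x k).
  exact: (gdna_step_le _ _ _ _ _ _ C11 s0 b0 (pd _ (xle k)) (step k)).
have xmono i j : (i <= j)%N -> phi (x j) <= phi (x i).
  by move=> /subnK <-; elim: (j - i)%N => // m; apply: le_trans; rewrite addSn.
have phi_near (e : R) : 0 < e -> exists2 d : R, 0 < d & forall y,
    enorm (y - xbar) < d -> `|phi xbar - phi y| < e.
  move=> e0; have /(_ xbar)/cvgrPdist_lt/(_ e e0)/nbhs_ballP[d /= d0 dP] :=
    C11_continuous _ _ C11.
  exists d => // y yx; apply: dP; rewrite mx_norm_ball /ball_ /=.
  by rewrite distrC; apply: le_lt_trans (norm_le_enorm _) _.
(* The values decrease along the sequence and come arbitrarily close to [phi xbar]; in particular
   [xbar] lies in the level set, where the Hessian is positive definite. *)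
have xbar_le k : phi xbar <= phi (x k).
  apply/ler_addgt0Pr => e /phi_near[d d0 dP].
  have [i ki /dP] := limiting_point_near _ _ xbarP d d0 k.
  by rewrite ltr_norml => /andP[_]; have := xmono _ _ ki; lra.
have pdbar : hessian_posdef G xbar.
  by apply: pd; apply: le_trans (xbar_le 0%N) _; rewrite xx0.
apply: (posdef_stationary_tilt_stable _ _ _ C11 pdbar); apply/eqP/negPn/negP => Gxbar.
(* An iterate close to a non-stationary [xbar] with value below [phi xbar + c] would have a
   successor with value below [phi xbar]. *)
have [c [e [c0 e0 ceP]]] := gdna_uniform_decrease _ _ _ _ _ C11 s01 b01 pdbar Gxbar.
have [d d0 dP] := phi_near c c0.
have [|k _] := limiting_point_near _ _ xbarP (Num.min e d) _ 0%N.
  by rewrite lt_min e0.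
rewrite lt_min => /andP[ke /dP]; rewrite ltr_norml => /andP[xk _].
have := ceP _ _ ke (step k); have := xbar_le k.+1; lra.
Qed.
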